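(* Let $T_n=\frac{1}{2n+1}\binom{3n}{n}$ and $U_n=\frac{1}{n+1}\binom{3n+1}{n}$ for integers $n\ge 0$ (so that $T_0=U_0=1$). The following relations hold for all $n\geq 1$: $$2\sum_{h=0}^{n-1}\frac{1}{h+1}T_hT_{n-h-1}=3U_{n-1}-T_n,$$ $$2\sum_{h=0}^{n-1}\frac{1}{3h+1}U_hU_{n-h-1}=4T_n-U_n.$$ *)

(* Defs.v *)
From mathcomp Require Import all_boot all_order all_algebra.

Set Implicit Arguments.
Unset Strict Implicit.
Unset Printing Implicit Defensive.

Import GRing.Theory Num.Theory.
Local Open Scope ring_scope.

Definition T (n : nat) : rat := (2 * n + 1)%N%:R^-1 * 'C(3 * n, n)%:R.

Definition U (n : nat) : rat := n.+1%:R^-1 * 'C(3 * n + 1, n)%:R.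

Lemma T0 : T 0 = 1.
Proof. by rewrite /T bin0 invr1 mulr1. Qed.

Lemma U0 : U 0 = 1.
Proof. by rewrite /U bin0 invr1 mulr1. Qed.

(* Main.v *)
(** With B the power series such that B = 1 + x B^3, the numbers T_n and U_n are the
    coefficients of x^n in B and B^2, and T_n / (n+1) = U_n / (3n+1) = (3 T_n - U_n) / 2.
    The two sums are therefore read off from B^r * B^s = B^(r+s) for r, s in {1, 2},
    together with x B^3 = B - 1 and x B^4 = B^2 - B. *)
Require Import Defs.
From mathcomp Require Import all_boot all_order all_algebra.
From mathcomp Require Import ring zify.
Import GRing.Theory Num.Theory.
Local Open Scope ring_scope.

(* [raney n r] is the coefficient of x^n in B^r; the recursion is
   B^(r+1) = B^r + x B^(r+3). *)
Fixpoint raney (n : nat) : nat -> nat :=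
  if n is n'.+1 then
    fix raneyS (r : nat) : nat :=
      if r is r'.+1 then (raneyS r' + raney n' r'.+3)%N else 0%N
  else fun=> 1%N.

Lemma raneySS n r : raney n.+1 r.+1 = (raney n.+1 r + raney n r.+3)%N.
Proof. by []. Qed.

(** Induction on [n], then on [r]: once the term [h = 0] is split off, the recursion turns the sum
    for [n.+1], [r.+1] into those for [n.+1], [r] and [n], [r.+3]. *)
Lemma raney_conv n r s :
  (\sum_(0 <= h < n.+1) raney h r * raney (n - h) s = raney n (r + s))%N.
Proof.
elim: n r => [|n IHn] r; first by rewrite big_nat1.
elim: r => [|r IHr].
  by rewrite big_nat_recl // big1 ?addn0 ?mul1n.
rewrite addSn raneySS -IHr -!addSn -IHn [LHS]big_nat_recl // [in RHS]big_nat_recl //.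
rewrite -addnA -big_split; congr (_ + _)%N.
by apply: eq_bigr => h _; rewrite raneySS mulnDl.
Qed.

Lemma raney_bin n r : ((3 * n + r) * raney n r = r * 'C(3 * n + r, n))%N.
Proof.
elim: n r => [|n IHn] r; first by rewrite bin0.
elim: r => [|r IHr]; first by rewrite muln0.
have {IHn} := IHn r.+3; move: IHr; rewrite raneySS.
have -> : (3 * n.+1 + r.+1 = (3 * n + r.+3).+1)%N by lia.
have -> : (3 * n.+1 + r = 3 * n + r.+3)%N by lia.
rewrite binS; have := mul_bin_left (3 * n + r.+3) n.
have -> : (3 * n + r.+3 - n = 2 * n + r.+3)%N by lia.
move: (raney _ _) (raney _ _) 'C(_, _) 'C(_, _) => a b d c Hd Ha Hb.
(* The positive factor [3 * n + r.+3] lets [Ha] and [Hb] be substituted; the two sides then differ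
   by 3 times [Hd]. *)
apply/eqP; rewrite -(@eqn_pmul2l (3 * n + r.+3)) ?addnS //; apply/eqP; nia.
Qed.

Lemma T_raney n : T n = (raney n 1)%:R.
Proof.
have raney1 : ((2 * n + 1) * raney n 1 = 'C(3 * n, n))%N.
  have := raney_bin n 1; have := mul_bin_down (3 * n + 1) n.
  by rewrite addn1 /= (_ : ((3 * n).+1 - n = 2 * n + 1)%N); [nia | lia].
by rewrite /T -raney1 natrM (@mulKf rat) // pnatr_eq0 addn1.
Qed.

Lemma raney2_bin n : (n.+1 * raney n 2 = 'C(3 * n + 1, n))%N.
Proof.
have := raney_bin n 2; have := mul_bin_down (3 * n + 2) n.
by rewrite addn2 addn1 /= (_ : ((3 * n).+2 - n = 2 * n.+1)%N); [nia | lia].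
Qed.

Lemma U_raney n : U n = (raney n 2)%:R.
Proof. by rewrite /U -raney2_bin natrM (@mulKf rat) // pnatr_eq0. Qed.

Lemma TU_ratio n : (3 * n + 1)%N%:R * T n = n.+1%:R * U n.
Proof. by rewrite T_raney U_raney -!natrM raney_bin raney2_bin mul1n. Qed.

(** This trades the weight depending on [n] for constant coefficients, so that weighted sums become
    plain convolutions. *)
Lemma T_divS n : 2 * (n.+1%:R^-1 * T n) = 3 * T n - U n.
Proof.
have n1_neq0 : n.+1%:R != 0 :> rat by rewrite pnatr_eq0.
apply: (mulfI n1_neq0); rewrite mulrBr -TU_ratio mulrCA mulVKf //.
by rewrite natrD natrM -natr1; ring.
Qed.

Lemma U_div3S n : (3 * n + 1)%N%:R^-1 * U n = n.+1%:R^-1 * T n.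
Proof.
have n1_neq0 : n.+1%:R != 0 :> rat by rewrite pnatr_eq0.
have n3_neq0 : (3 * n + 1)%N%:R != 0 :> rat by rewrite pnatr_eq0 addn1.
apply: (mulfI n1_neq0); rewrite mulVKf // mulrCA -TU_ratio.
by rewrite mulKf.
Qed.

Lemma sum_raney n r s :
  \sum_(0 <= h < n.+1) (raney h r)%:R * (raney (n - h) s)%:R
    = (raney n (r + s))%:R :> rat.
Proof.
rewrite -raney_conv natr_sum.
by apply: eq_bigr => h _; rewrite natrM.
Qed.

(** Coefficient form of (3B - B^2) B^s; [s = 1] serves the first sum, and [s = 2] the second, by
    [U_div3S]. *)
Lemma sum_T_divS_raney n s :
  2 * (\sum_(0 <= h < n.+1) h.+1%:R^-1 * T h * (raney (n - h) s)%:R)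
    = 3 * (raney n s.+1)%:R - (raney n s.+2)%:R.
Proof.
rewrite -(sum_raney n 1) -(sum_raney n 2) !mulr_sumr -sumrB.
by apply: eq_bigr => h _; rewrite mulrA T_divS mulrBl -mulrA T_raney U_raney.
Qed.

Theorem proposition4p2 (n : nat) (hn : (1 <= n)%N) :
  2 * (\sum_(0 <= h < n) h.+1%:R^-1 * T h * T (n - h - 1)) = 3 * U (n - 1) - T n
  /\
  2 * (\sum_(0 <= h < n) (3 * h + 1)%N%:R^-1 * U h * U (n - h - 1)) = 4 * T n - U n.
Proof.
case: n hn => // n _; have subE h : (n.+1 - h - 1 = n - h)%N by lia.
(* This is B - 1 = x B^3, since [raney n.+1 0] is 0. *)
have TS : T n.+1 = (raney n 3)%:R by rewrite T_raney.
rewrite subn1 /=; split.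
  rewrite TS U_raney -sum_T_divS_raney; congr (_ * _).
  by apply: eq_bigr => h _; rewrite subE (T_raney (n - h)).
(* This is B^2 = B + x B^4; it turns [4 * T n.+1 - U n.+1] into the coefficient of 3B^3 - B^4. *)
have -> : U n.+1 = T n.+1 + (raney n 4)%:R.
  by rewrite U_raney T_raney raneySS natrD.
transitivity (3 * (raney n 3)%:R - (raney n 4)%:R : rat); last by rewrite TS; ring.
rewrite -sum_T_divS_raney; congr (_ * _).
by apply: eq_bigr => h _; rewrite subE U_div3S (U_raney (n - h)).
Qed.
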